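(* Assume that every multigraph $G$ satisfies $\xi(G)\ge \min\{\delta(G)-1,\ \lfloor \Phi(G)\rfloor\}$. Then every multigraph $G$ such that $\delta(G)$ cannot be written in the form $2p\mu(G)-q$ for any integers $p,q$ with $q\ge 0$ and $p>\mu(G)+\lfloor (q-1)/2\rfloor$ satisfies $\xi(G)\ge \delta(G)-\mu(G)+1$.
   Context: Multigraphs are finite, may have parallel edges, and have no loops. For a multigraph $G=(V,E)$: $\delta(G)$ is its minimum degree and $\mu(G)$ is the maximum multiplicity of an edge (maximum number of edges joining a pair of vertices). For $U\subseteq V$, $E^+(U)$ is the set of edges with at least one end in $U$. The co-density is $\Phi(G)=\min\{\frac{2|E^+(U)|}{|U|+1}: U\subseteq V,\ |U|\ge 3,\ |U| \text{ odd}\}$. The cover index $\xi(G)$ is the greatest integer $k$ such that $E$ can be colored with $k$ colors so that every vertex of $G$ is incident with at least one edge of each color. *)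

(* Defs.v *)
From mathcomp Require Import all_boot all_order all_algebra.
From mathcomp Require Import constructive_ereal.

Set Implicit Arguments.
Unset Strict Implicit.
Unset Printing Implicit Defensive.

Import Order.TTheory GRing.Theory Num.Theory.

(* Edges form a type of their own, so several edges may have the same ends;
   an edge has two distinct ends, so there are no loops. The vertex set is
   nonempty, since otherwise the minimum degree is undefined. *)
Record multigraph := Multigraph {
  vertex : finType;
  edge : finType;
  ends : edge -> {set vertex};
  card_ends : forall e, #|ends e| = 2;
  vertex_gt0 : 0 < #|vertex| }.

Section Invariants.

Variable G : multigraph.

Definition deg (v : vertex G) : nat := #|[set e : edge G | v \in ends e]|.

(* As every degree is at most #|edge G| and there is a vertex, the default
   value #|edge G| does not affect the minimum. *)
Definition min_degree : nat := \big[minn/#|edge G|]_(v : vertex G) deg v.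

Definition multiplicity (u v : vertex G) : nat :=
  #|[set e : edge G | ends e == [set u; v]]|.

Definition max_multiplicity : nat :=
  \max_(p : vertex G * vertex G | p.1 != p.2) multiplicity p.1 p.2.

Definition edges_meeting (U : {set vertex G}) : {set edge G} :=
  [set e | ends e :&: U != set0].

(* A graph with fewer than three vertices has co-density +oo (the minimum of
   the empty set). *)
Definition codensity : \bar rat :=
  \big[Order.min/+oo%E]_(U : {set vertex G} | (3 <= #|U|) && odd #|U|)
    ((2 * #|edges_meeting U|)%N%:R / (#|U| + 1)%N%:R)%R%:E.

Definition cover_colorable (k : nat) : bool :=
  [exists c : {ffun edge G -> 'I_k}, forall v : vertex G, forall i : 'I_k,
     exists e : edge G, (v \in ends e) && (c e == i)].

(* A graph with a vertex is cover k-colorable only for k <= #|edge G|, so the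
   bound on k loses nothing. If there are edges and also isolated vertices,
   then no k qualifies (there is no map to the empty set of colors) and the
   maximum is 0. *)
Definition cover_index : nat :=
  \max_(k < #|edge G|.+1 | cover_colorable k) k.

End Invariants.

(* Main.v *)
(* If a set U with |U| = 2k+1 forces the co-density below delta - mu + 1, then
   |E^+(U)| < (delta - mu + 1)(k + 1). Counting each edge at U at most twice
   gives 2|E^+(U)| >= delta(2k + 1), and bounding the number of edges inside U
   by mu k(2k + 1) gives |E^+(U)| >= (delta - mu k)(2k + 1). For mu >= 1 the
   second bound makes q := 2 k mu - delta nonnegative, and the first one makes
   2k >= 2 mu + q, so delta is excluded, with p = k. When mu = 1 the bound
   delta - 1 of the hypothesis is too weak, but then only delta <= 1 is not
   excluded. *)
Require Import Defs.
From mathcomp Require Import all_boot all_order all_algebra.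
From mathcomp Require Import constructive_ereal.
From mathcomp Require Import zify.
Import Order.TTheory GRing.Theory Num.Theory.
Local Open Scope ring_scope.

Section Counting.

Variable G : multigraph.
Implicit Types (U : {set vertex G}) (v : vertex G).

Lemma min_degree_le v : (min_degree G <= deg v)%N.
Proof.
rewrite /min_degree; elim: index_enum (mem_index_enum v) => // u s IH.
rewrite big_cons inE => /predU1P[<-|/IH le]; first exact: geq_minl.
by rewrite geq_min le orbT.
Qed.

Lemma multiplicity_le u v :
  u != v -> (multiplicity u v <= max_multiplicity G)%N.
Proof.
move=> uv; rewrite /max_multiplicity.
exact: (@leq_bigmax_cond _ (fun p => p.1 != p.2)
  (fun p => multiplicity p.1 p.2) (u, v)).
Qed.

(** Both sides count the incidences between vertices of [U] and edges. *)
Lemma sum_deg U : (\sum_(v in U) deg v = \sum_e #|ends e :&: U|)%N.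
Proof.
under eq_bigr => v _ do rewrite /deg -sum1dep_card big_mkcond /=.
rewrite exchange_big /=; apply: eq_bigr => e _.
rewrite -big_mkcondr /= -sum1_card; apply: eq_bigl => v.
by rewrite inE andbC.
Qed.

Lemma min_degree_sum U : (#|U| * min_degree G <= \sum_(v in U) deg v)%N.
Proof. by rewrite -sum_nat_const leq_sum // => v _; exact: min_degree_le. Qed.

Lemma min_degree_edges_meeting U :
  (#|U| * min_degree G <= 2 * #|edges_meeting U|)%N.
Proof.
apply: leq_trans (min_degree_sum U) _.
rewrite sum_deg mulnC -sum_nat_const [leqRHS]big_mkcond /=.
apply: leq_sum => e _; rewrite inE.
case: eqP => [->|_] /=; first by rewrite cards0.
by rewrite -(card_ends e) subset_leq_card ?subsetIl.
Qed.

(** An edge with exactly one end in [U] adds 1 to the degree sum; an edge with both ends in [U] adds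
    2, once in each term on the right. *)
Lemma sum_deg_edges_meeting U :
  (\sum_(v in U) deg v
    = #|edges_meeting U| + #|[set e : edge G | ends e \subset U]|)%N.
Proof.
rewrite sum_deg -[X in (X + _)%N]sum1_card -[X in (_ + X)%N]sum1_card.
rewrite [X in (X + _)%N]big_mkcond [X in (_ + X)%N]big_mkcond -big_split /=.
apply: eq_bigr => e _; rewrite !inE.
have le2 : (#|ends e :&: U| <= 2)%N.
  by rewrite -(card_ends e) subset_leq_card ?subsetIl.
have -> : (ends e \subset U) = (#|ends e :&: U| == 2%N).
  rewrite (sameP setIidPl eqP) -(card_ends e).
  by rewrite (subset_leqif_cards (subsetIl _ _)).
by rewrite -card_gt0; case: #|_| le2 => [|[|[|]]].
Qed.

(** Grouped by their pair of ends, these edges fall into classes indexed by the 2-subsets of [U],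
    each class having at most the maximum multiplicity. *)
Lemma card_edges_inside U :
  (#|[set e : edge G | ends e \subset U]| <= 'C(#|U|, 2) * max_multiplicity G)%N.
Proof.
rewrite -sum1dep_card -cards_draws -sum_nat_const.
rewrite (partition_big (@ends G) [in [set A : {set vertex G} | A \subset U & #|A| == 2%N]]) /=.
  apply: leq_sum => A; rewrite inE => /andP[_ /cards2P[x [y [xy ->]]]].
  apply: leq_trans (multiplicity_le x y xy).
  rewrite sum1dep_card subset_leq_card //.
  by apply/subsetP => e; rewrite !inE => /andP[].
by move=> e eU; rewrite inE eU card_ends eqxx.
Qed.

Lemma deficient_set_excludes U (k : nat) :
    (0 < k)%N -> #|U| = k.*2.+1 -> (0 < max_multiplicity G)%N ->
    #|edges_meeting U|%:Z <
      ((min_degree G)%:Z - (max_multiplicity G)%:Z + 1) * k.+1%:Z ->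
  exists p q : int,
    [/\ 0 <= q, (min_degree G)%:Z = 2 * p * (max_multiplicity G)%:Z - q
      & (max_multiplicity G)%:Z + ((q - 1) %/ 2)%Z < p].
Proof.
move=> k0 Uk mu0 few.
have twice := min_degree_edges_meeting U.
have inside := card_edges_inside U.
have := min_degree_sum U; rewrite sum_deg_edges_meeting => sum.
have binU : 'C(#|U|, 2) = (k * k.*2.+1)%N.
  by rewrite bin2 Uk /= -doubleMr mulnC half_double.
rewrite binU in inside; rewrite Uk in twice sum.
move: few twice inside sum; set d := min_degree G; set mu := max_multiplicity G.
set E := #|edges_meeting U|; set I := #|[set _ | _]| => few twice inside sum.
exists k%:Z, (2 * k%:Z * mu%:Z - d%:Z); split; [|lia|].
(* [few], [inside] and [sum] give k(d - 2k mu) < k + 1 - mu, and mu >= 1; dividing by k yields q >=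
   0. *)
- have : (k%:Z * (d%:Z - 2 * k%:Z * mu%:Z) < k%:Z * 1) by nia.
  rewrite ltr_pM2l; lia.
(* Strictness in [few] gives 2E + 2 <= 2(k + 1)(d - mu + 1), to be compared with [twice]. Then
   floor((q - 1)/2) < q/2 makes the last bound strict. *)
- have : (2 * k%:Z >= 2 * mu%:Z + (2 * k%:Z * mu%:Z - d%:Z)) by nia.
  lia.
Qed.

Lemma codensity_ge :
    (0 < max_multiplicity G)%N ->
    ~ (exists p q : int,
         [/\ 0 <= q,
             (min_degree G)%:Z = 2 * p * (max_multiplicity G)%:Z - q
           & (max_multiplicity G)%:Z + ((q - 1) %/ 2)%Z < p]) ->
  ((((min_degree G)%:Z - (max_multiplicity G)%:Z + 1)%:~R)%:E
     <= codensity G)%E.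
Proof.
move=> mu0 nexc; rewrite /codensity.
elim/big_ind: _ => [|x y lx ly|U /andP[U3 Uodd]]; first exact: leey.
  by rewrite le_min lx.
rewrite lee_fin.
have Uk : #|U| = (#|U|./2).*2.+1 by rewrite -{1}(odd_double_half #|U|) Uodd.
have k0 : (0 < #|U|./2)%N by lia.
rewrite leNgt; apply/negP => few; apply: nexc.
apply: (deficient_set_excludes U #|U|./2 k0 Uk mu0).
(* With |U| + 1 = 2(k + 1), the factor 2 cancels on both sides. *)
move: few; rewrite ltr_pdivrMr ?ltr0n ?addn1 //.
rewrite !pmulrn -intrM ltr_int; lia.
Qed.

Lemma max_multiplicity_gt0 : edge G -> (0 < max_multiplicity G)%N.
Proof.
move=> e; have /eqP/cards2P[x [y [xy exy]]] := card_ends e.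
apply: leq_trans (multiplicity_le x y xy).
by rewrite card_gt0; apply/set0Pn; exists e; rewrite inE exy.
Qed.

Lemma min_degree_gt0_incident v :
  (0 < min_degree G)%N -> exists e : edge G, v \in ends e.
Proof.
move=> d0; have := leq_trans d0 (min_degree_le v).
by rewrite card_gt0 => /set0Pn[e]; rewrite inE; exists e.
Qed.

Lemma min_degree_gt0_edge : (0 < min_degree G)%N -> edge G.
Proof.
move=> d0; case: (pickP (@predT (edge G))) => [e _ //|noe].
exfalso; have /card_gt0P[v _] := vertex_gt0 G.
by have [e _] := min_degree_gt0_incident v d0; have := noe e.
Qed.

(** A single color on all edges covers every vertex. This settles the case where degree and
    multiplicity are both 1. *)
Lemma cover_index_gt0 : (0 < min_degree G)%N -> (0 < cover_index G)%N.
Proof.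
move=> d0; have e := min_degree_gt0_edge d0.
have E0 : (1 < #|edge G|.+1)%N by rewrite ltnS; apply/card_gt0P; exists e.
have col1 : cover_colorable G 1.
  apply/existsP; exists [ffun=> ord0]; apply/forallP => v; apply/forallP => i.
  have [f vf] := min_degree_gt0_incident v d0.
  by apply/existsP; exists f; rewrite vf ffunE [i]ord1.
exact: (@leq_bigmax_cond _ (fun k : 'I_#|edge G|.+1 => cover_colorable G k)
  (fun k => val k) (Ordinal E0)).
Qed.

End Counting.

Theorem theorem2 :
  (forall G : multigraph,
     (Order.min (((min_degree G)%:Z - 1)%:E) (er_map Num.floor (codensity G))
        <= ((cover_index G)%:Z)%:E)%E) ->
  forall G : multigraph,
    ~ (exists p q : int,
         [/\ 0 <= q,
             (min_degree G)%:Z = 2 * p * (max_multiplicity G)%:Z - q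
           & (max_multiplicity G)%:Z + ((q - 1) %/ 2)%Z < p]) ->
    (min_degree G)%:Z - (max_multiplicity G)%:Z + 1 <= (cover_index G)%:Z.
Proof.
move=> conj G nexc.
have [mu0|mu0] := posnP (max_multiplicity G).
  (* Without edges the minimum degree is 0, which is excluded by p = q = 0, as floor(-1/2) = -1. *)
  exfalso; apply: nexc; exists 0, 0; split=> //; last by rewrite mu0.
  have [-> //|/(min_degree_gt0_edge G) e] := posnP (min_degree G).
  by have := max_multiplicity_gt0 G e; rewrite mu0.
have [mu1|mu2] : (max_multiplicity G = 1 \/ 1 < max_multiplicity G)%N by lia.
  have [d2|d1] := ltnP 1 (min_degree G).
    (* Rounding up to an even number: p = ceil(delta/2), and q is the parity of delta. An odd delta
       is at least 3, so p > 1. *)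
    exfalso; apply: nexc; exists (uphalf (min_degree G))%:Z.
    exists (odd (min_degree G))%:Z.
    by rewrite mu1; split; lia.
  have [->|/[dup] d0 /(cover_index_gt0 G)] := posnP (min_degree G); lia.
have := codensity_ge G mu0 nexc; have := conj G.
case: (codensity G) => [r||] /=.
(* An integer below the co-density is below its floor; and delta - 1 suffices because mu >= 2. *)
- rewrite lee_fin -floor_ge_int ge_min !lee_fin => /orP[le _|le].
    apply: le_trans le; lia.
  by move=> /le_trans; exact.
- rewrite ge_min lee_fin => /orP[le _|//].
  apply: le_trans le; lia.
- by [].
Qed.
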